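(* Let $\kappa,\lambda$ be cardinals with $\omega_1 \le \kappa \le \lambda \le 2^{\omega}$, and assume the ideal $\mathcal{M}$ of meager subsets of the Cantor space $2^\omega$ is $(\kappa,\lambda)$-nicely generated. Then $\kappa=\lambda$.
   Context: $2^\omega$ carries the product topology ($2$ discrete). For a set $X$, cardinals $\kappa\le\lambda\le|X|$, and an ideal $\mathcal{I}\subseteq P(X)$ (with $\bigcup\mathcal{I}=X$ and $X\notin\mathcal{I}$), $\mathcal{I}$ is called $(\kappa,\lambda)$-nicely generated if there is a partition $\langle X_\alpha : \alpha<\lambda\rangle$ of $X$ with each $X_\alpha\in\mathcal{I}$ such that (i) $\bigcup_{\alpha\in\Delta}X_\alpha\in\mathcal{I}$ for every $\Delta\subseteq\lambda$ with $|\Delta|<\kappa$, and (ii) for every $Y\in\mathcal{I}$ there is $\Delta\subseteq\lambda$ with $|\Delta|<\kappa$ and $Y\subseteq\bigcup_{\alpha\in\Delta}X_\alpha$. *)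

(* Defs.v *)
From HB Require Import structures.
From mathcomp Require Import all_boot all_order.
From mathcomp Require Import boolp classical_sets functions cardinality wochoice.
From mathcomp Require Import topology cantor.

Set Implicit Arguments.
Unset Strict Implicit.
Unset Printing Implicit Defensive.

Local Open Scope classical_set_scope.
Local Open Scope card_scope.

(* Cardinals are represented by types (or sets) up to equipotence. *)
Definition card_lt (T U : Type) (A : set T) (B : set U) : Prop :=
  A #<= B /\ ~ (B #<= A).

(* An uncountable well-ordered set all of whose initial segments are countable:
   its order type is the first uncountable ordinal. [R] may be
   arbitrary outside [W]. *)
Definition is_omega1 (T : Type) (W : set T) : Prop :=
  exists R : rel T,
    [/\ wo_chain R [in W], ~ countable W
      & forall w, W w -> countable (W `&` [set v | R v w])].

Lemma uncountable_cantor : ~ countable [set: cantor_space].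
Proof.
move=> /countable_injP[f finj].
pose d : cantor_space := fun n => `[< exists2 x : cantor_space, f x = n & ~~ x n >].
have /negP := @negbT _ erefl; case dE : (d (f d)).
  move: (dE) => /asboolP[x fxd]; have -> : x = d by apply: finj; rewrite ?inE.
  by rewrite dE.
by move/negbT/asboolPn : (dE) => []; exists d => //; rewrite dE.
Qed.

Lemma omega1_exists : exists W : set cantor_space, is_omega1 W.
Proof.
have [R Rwo] := well_ordering_principle cantor_space.
have woR (C : {pred cantor_space}) : wo_chain R C by move=> A _; exact: Rwo.
pose seg a := [set v | R v a].
have [[a0 a0P]|none] := pselect (exists a, ~ countable (seg a)); last first.
  exists setT, R; split; [exact: woR|exact: uncountable_cantor|].
  move=> w _; rewrite setTI; apply: contrapT => ?; by apply: none; exists w.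
have [|a [[aP amin] _]] := Rwo [pred a | `[< ~ countable (seg a) >]].
  by exists a0; apply/asboolP.
move/asboolP : aP => aP.
have Ranti x y : R x y -> R y x -> x = y.
  move=> xy yx; have /(_ x y) := wo_chain_antisymmetric (woR predT).
  by apply => //; rewrite xy yx.
exists (seg a `\ a), R; split; first exact: woR.
  move=> cnt; apply: aP.
  have : countable (seg a `\ a `|` [set a]).
    have -> : seg a `\ a `|` [set a] = \bigcup_(b in [set: bool])
        (if b then seg a `\ a else [set a]).
      apply/seteqP; split => x; first by case=> ?; [exists true|exists false].
      by case=> -[] _; [left|right].
    by apply: bigcup_countable => // -[] _ //; exact: countable1.
  apply: sub_countable; apply: subset_card_le => x xa.
  by have [->|xNa] := pselect (x = a); [right|left].
move=> w [wa wNa]; apply: contrapT => wP; apply: wNa.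
apply: Ranti => //; apply: amin; apply/asboolP => cnt; apply: wP.
by apply: sub_countable cnt; apply: subset_card_le => x [].
Qed.

Definition omega1 : set cantor_space := projT1 (cid omega1_exists).

Lemma omega1P : is_omega1 omega1.
Proof. exact: projT2 (cid omega1_exists). Qed.

Definition nowhere_dense (T : topologicalType) (A : set T) : Prop :=
  (closure A)° = set0.

Definition meager (T : topologicalType) (A : set T) : Prop :=
  exists2 F : nat -> set T,
    (forall n, nowhere_dense (F n)) & A = \bigcup_n F n.

(* The library's [partition] requires the blocks to be nonempty. [I] is meant to
   be a proper ideal covering [X]; these conditions are not repeated here, so a
   hypothesis [nicely_generated kappa lambda I] does not assume them. *)
Definition nicely_generated (kappa lambda X : Type) (I : set (set X)) : Prop :=
  exists F : lambda -> set X,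
    [/\ partition [set: lambda] F [set: X],
        (forall a, I (F a)),
        (forall D : set lambda, card_lt D [set: kappa] ->
           I (\bigcup_(a in D) F a))
      & (forall Y : set X, I Y -> exists D : set lambda,
           card_lt D [set: kappa] /\ Y `<=` \bigcup_(a in D) F a)].
Arguments nicely_generated kappa lambda {X} I.

(* Main.v *)
Require Import Defs.
From mathcomp Require Import all_boot all_order.
From mathcomp Require Import boolp classical_sets functions cardinality.
From mathcomp Require Import topology cantor.

(** Suppose kappa < lambda. Since kappa * kappa = kappa, kappa meager sets meet
    at most kappa blocks, so they do not cover the Cantor space C; and a set Z
    with one point in each of kappa blocks is nonmeager. Identify C with C x C.
    Every line {x} x C or C x {z} is meager, hence meets fewer than kappa blocks.
    So there are at most kappa pairs (z, a) with z in Z and block a meeting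
    C x {z}, and some x avoids all the meager sections at height z of such
    blocks a. The union Q of the blocks meeting {x} x C is meager, so by
    Kuratowski-Ulam some z in Z has a meager section of Q. The block of (x, z)
    is part of Q, so its section at z is meager and contains x: a contradiction.
*)

Local Open Scope classical_set_scope.
Local Open Scope card_scope.

(** * Cardinal arithmetic *)

(** Allows injections to be given as relations on the ambient types rather than maps between
    subtypes. [R] may be multivalued, since choice picks one partner for each point and injectivity
    survives. *)
Lemma card_le_relP (T U : Type) (A : set T) (B : set U) :
  A #<= B <-> exists R : T -> U -> Prop,
    (forall a, A a -> exists2 b, B b & R a b) /\
    (forall a a' b, A a -> A a' -> R a b -> R a' b -> a = a').
Proof.
split=> [/card_leP[f]|[R [Rtot Rinj]]].
  exists (fun a b => exists2 x : A, val x = a & val (f x) = b); split.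
    move=> a Aa; exists (val (f (SigSub (mem_set Aa)))).
      exact/set_mem/valP.
    by exists (SigSub (mem_set Aa)).
  move=> a a' b _ _ [x <- <-] [x' <- /val_inj fxx'].
  by congr val; apply/esym; apply: (@inj _ _ setT f) fxx'; rewrite in_setT.
have h (x : A) : {b : B | R (val x) (val b)}.
  have /cid2[b Bb Rab] := Rtot _ (set_mem (valP x)).
  by exists (SigSub (mem_set Bb)).
apply/card_leP.
have /Pinj[f _] : {in [set: A] &, injective (fun x => sval (h x))}.
  move=> x y _ _ xy; apply: val_inj; apply: (Rinj _ _ (val (sval (h x)))).
  - exact/set_mem/valP.
  - exact/set_mem/valP.
  - exact: svalP (h x).
  - by rewrite xy; exact: svalP (h y).
have /injPfun[g _] : {homo f : x / [set: A] x >-> [set: B] x} by [].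
by squash g.
Qed.

(** Zorn on partial matchings between [A] and [B]: if a maximal one left both some [a] and some [b]
    unmatched, the pair [(a, b)] could be added. *)
Lemma card_le_total (T U : Type) (A : set T) (B : set U) :
  A #<= B \/ B #<= A.
Proof.
pose Q (G : set (T * U)) := [/\ (forall p, G p -> A p.1 /\ B p.2),
  (forall a a' b, G (a, b) -> G (a', b) -> a = a') &
  (forall a b b', G (a, b) -> G (a, b') -> b = b')].
have [|G [[GAB Ginj Gfun] Gmax]] := @Zorn_bigcup _ Q.
  move=> F FQ Ftot; split.
  - by move=> p [G /FQ[+ _ _] Gp]; exact.
  - move=> a a' b [G FG Gp] [G' FG' Gp'].
    have [GG'|G'G] := Ftot _ _ FG FG'.
    + by have [_ + _] := FQ _ FG'; apply; [exact: GG' Gp|].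
    + by have [_ + _] := FQ _ FG; apply; [|exact: G'G Gp'].
  - move=> a b b' [G FG Gp] [G' FG' Gp'].
    have [GG'|G'G] := Ftot _ _ FG FG'.
    + by have [_ _] := FQ _ FG'; apply; [exact: GG' Gp|].
    + by have [_ _] := FQ _ FG; apply; [|exact: G'G Gp'].
have [domG|] := pselect (forall a, A a -> exists b, G (a, b)).
  left; apply/card_le_relP; exists (fun a b => G (a, b)); split.
    by move=> a /domG[b Gab]; exists b => //; have [] := GAB _ Gab.
  by move=> a a' b _ _; exact: Ginj.
move=> /existsNP[a /not_implyP[Aa aG]].
right; apply/card_le_relP; exists (fun b a => G (a, b)); split; last first.
  by move=> b b' x _ _; exact: Gfun.
move=> b Bb; apply: contrapT => bG.
apply: (Gmax (G `|` [set (a, b)])).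
  split; first by left.
  by move=> /(_ (a, b) (or_intror erefl)) Gab; apply: aG; exists b.
split.
- by move=> p [/GAB//|->].
- move=> x x' y [Gx|[-> yb]] [Gx'|[-> yb']] //; first exact: Ginj Gx Gx'.
  + by case: bG; exists x; [case: (GAB _ Gx)|rewrite -yb'].
  + by case: bG; exists x'; [case: (GAB _ Gx')|rewrite -yb].
- move=> x y y' [Gx|[xa ->]] [Gx'|[xa' ->]] //; first exact: Gfun Gx Gx'.
  + by case: aG; exists y; rewrite -xa'.
  + by case: aG; exists y'; rewrite -xa.
Qed.

Lemma card_le_subset (T U : Type) (A : set T) (C : set U) :
  A #<= C -> exists2 B, B `<=` C & A #= B.
Proof.
move=> /card_leP[f]; exists [set val (f x) | x in [set: A]].
  by move=> _ [x _ <-]; exact/set_mem/valP.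
apply: Cantor_Bernstein.
  apply/card_le_relP.
  exists (fun a b => exists2 x : A, val x = a & val (f x) = b); split.
    move=> a Aa; pose x : A := SigSub (mem_set Aa).
    by exists (val (f x)); [exists x|exists x].
  move=> a a' b _ _ [x <- <-] [x' <- /val_inj fxx'].
  by congr val; apply/esym; apply: (@inj _ _ setT f) fxx'; rewrite in_setT.
apply/card_le_relP.
exists (fun b a => exists2 x : A, val x = a & val (f x) = b); split.
  by move=> _ [x _ <-]; exists (val x); [exact/set_mem/valP|exists x].
by move=> b b' a _ _ [x <- <-] [x' /val_inj -> <-].
Qed.

Lemma card_le_setX (T T' U U' : Type) (A : set T) (A' : set T')
    (B : set U) (B' : set U') :
  A #<= B -> A' #<= B' -> A `*` A' #<= B `*` B'.
Proof.
move=> /card_le_relP[R [Rtot Rinj]] /card_le_relP[S [Stot Sinj]].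
apply/card_le_relP; exists (fun p q => R p.1 q.1 /\ S p.2 q.2); split.
  move=> [a a'] [/= /Rtot[b Bb Rab] /Stot[b' Bb' Sab]].
  by exists (b, b').
move=> [a a'] [x x'] [b b'] /= [Aa Aa'] [Ax Ax'] [/= Rab Sab] [Rxb Sxb].
by congr pair; [exact: Rinj Rxb|exact: Sinj Sxb].
Qed.

(** Two distinct tags [c0] and [c1] send the two sets to disjoint copies inside the square of [C].
    The bound on that square is a hypothesis because the lemma serves in the proof of the general
    bound below. *)
Lemma card_le_setU (T U : Type) (A B : set T) (C : set U) :
  infinite_set C -> C `*` C #<= C -> A #<= C -> B #<= C -> A `|` B #<= C.
Proof.
move=> Cinf CC /card_le_relP[R [Rtot Rinj]] /card_le_relP[S [Stot Sinj]].
have : [set: nat] #<= C by apply/infiniteP.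
move=> /card_le_relP[N [Ntot Ninj]].
have [c0 Cc0 Nc0] := Ntot 0%N I; have [c1 Cc1 Nc1] := Ntot 1%N I.
apply: card_le_trans CC; apply/card_le_relP.
exists (fun a c => (A a /\ R a c.1 /\ c.2 = c0) \/
  (B a /\ S a c.1 /\ c.2 = c1)); split.
  move=> a [Aa|Ba].
    by have [b Cb Rab] := Rtot _ Aa; exists (b, c0) => //; left.
  by have [b Cb Sab] := Stot _ Ba; exists (b, c1) => //; right.
have c01 : c0 <> c1 by move=> c01; rewrite c01 in Nc0; have := Ninj _ _ _ I I Nc0 Nc1.
move=> a a' [b c] _ _ /= [[Aa [Ra ->]]|[Ba [Sa ->]]] [[Aa' [Ra' c']]|[Ba' [Sa' c']]].
- exact: Rinj Ra Ra'.
- by [].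
- by case: c01.
- exact: Sinj Sa Sa'.
Qed.

(** Zorn on injective relations [G] from the square of a carrier into that carrier, the carrier
    [dom G] being read off the diagonal. A maximal carrier turns out to be as large as [T]. *)
Lemma infinite_setX_card_le (T : Type) :
  infinite_set [set: T] -> [set: T * T] #<= [set: T].
Proof.
move=> Tinf; pose dom (G : set (T * T * T)) := [set a | exists c, G (a, a, c)].
pose Q (G : set (T * T * T)) := [/\
  (forall p c, G (p, c) -> [/\ dom G p.1, dom G p.2 & dom G c]),
  (forall a b, dom G a -> dom G b -> exists c, G (a, b, c)) &
  (forall p p' c, G (p, c) -> G (p', c) -> p = p')].
have domS G G' : G `<=` G' -> dom G `<=` dom G'.
  by move=> GG' a [c Gc]; exists c; exact: GG'.
have [|G [[Gsub Gtot Ginj] Gmax]] := @Zorn_bigcup _ Q.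
  move=> F FQ Ftot; have Fsub G : F G -> G `<=` \bigcup_(X in F) X.
    by move=> FG p Gp; exists G.
  split.
  - move=> p c [G FG Gp]; have [/(_ _ _ Gp)[d1 d2 dc] _ _] := FQ _ FG.
    by split; apply: domS (Fsub _ FG) _ _.
  - move=> a b [c [G FG Gc]] [c' [G' FG' Gc']].
    wlog GG' : a b c c' G G' FG FG' Gc Gc' / G `<=` G' => [hw|].
      have [GG'|G'G] := Ftot _ _ FG FG'; first exact: (hw a b c c' G G').
      have [_ /(_ a b) + _] := FQ _ FG; case.
      + by exists c.
      + by exists c'; exact: G'G.
      + by move=> d Gd; exists d; exists G.
    have [_ /(_ a b) + _] := FQ _ FG'; case.
    + by exists c; exact: GG'.
    + by exists c'.
    + by move=> d Gd; exists d; exists G'.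
  - move=> p p' c [G FG Gp] [G' FG' Gp'].
    have [GG'|G'G] := Ftot _ _ FG FG'.
    + by have [_ _] := FQ _ FG'; apply; [exact: GG' Gp|exact: Gp'].
    + by have [_ _] := FQ _ FG; apply; [exact: Gp|exact: G'G Gp'].
set A := dom G in Gsub Gtot.
have AA : A `*` A #<= A.
  apply/card_le_relP; exists (fun p c => G (p, c)); split.
    move=> [a b] [Aa Ab]; have [c Gc] := Gtot _ _ Aa Ab.
    by exists c => //; have [] := Gsub _ _ Gc.
  by move=> p p' c _ _; exact: Ginj.
(* Pairs not already in the square of [A] would get values in [B]. Old values lie in [A], so the
   extended relation stays injective, against maximality. *)
have noext B : B `<=` ~` A -> infinite_set B ->
    ~ ((A `|` B) `*` (A `|` B) #<= B).
  move=> BA /infinite_setN0[b Bb] /card_le_relP[R [Rtot Rinj]].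
  pose new p c := [/\ (A `|` B) p.1, (A `|` B) p.2, ~ (A p.1 /\ A p.2),
    B c & R p c].
  pose G' := G `|` [set pc | new pc.1 pc.2].
  have domG' : dom G' = A `|` B.
    apply/seteqP; split => [a [c [Gc|[]//]]|a [[c Gc]|Ba]].
    - by left; exists c.
    - by exists c; left.
    - have [c Bc Rc] := Rtot (a, a) (conj (or_intror Ba) (or_intror Ba)).
      by exists c; right; split=> //=; [right|right|case=> /(BA _ Ba)].
  have [c G'c] : dom G' b by rewrite domG'; right.
  apply: (Gmax G').
    split; first by left.
    by move=> /(_ _ G'c) Gc; apply: (BA _ Bb); exists c.
  split; rewrite ?domG'.
  - move=> p d [/Gsub[? ? ?]|[/= ? ? _ ? _]].
      by split; left.
    by split => //; right.
  - move=> x y ABx ABy; have [[Ax Ay]|nA] := pselect (A x /\ A y).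
      by have [d Gd] := Gtot _ _ Ax Ay; exists d; left.
    have [d Bd Rd] := Rtot (x, y) (conj ABx ABy).
    by exists d; right; split.
  - move=> p p' d [Gp|[/= p1 p2 _ Bd Rp]] [Gp'|[/= p1' p2' _ Bd' Rp']].
    + exact: Ginj Gp Gp'.
    + by have [_ _ /(BA _ Bd')] := Gsub _ _ Gp.
    + by have [_ _ /(BA _ Bd)] := Gsub _ _ Gp'.
    + exact: Rinj Rp Rp'.
(* A finite carrier, possibly empty, can be enlarged by a countably infinite [B] outside it, since
   the square of a countable set is countable. *)
have [Afin|Ainf] := pselect (finite_set A).
  have /infiniteP/card_le_subset[B BA natB] : infinite_set (~` A).
    move=> Acfin; apply: Tinf; rewrite -(setUv A).
    by rewrite finite_setU; split.
  have Binf : infinite_set B by apply/infiniteP; rewrite -(card_le_eqr natB).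
  case: (noext _ BA Binf); move/infiniteP: Binf; apply: card_le_trans.
  have cAB : countable (A `|` B).
    apply: card_le_setU; first exact: infinite_nat.
    - exact: countableP.
    - exact: finite_set_countable.
    - by rewrite -[_ #<= _](eq_countable natB).
  exact: countableX.
(* A copy [B] of [A] in the complement would again allow an extension; otherwise the complement
   embeds in [A], and so does all of [T]. *)
have [/card_le_subset[B BA AB]|AcA] := card_le_total _ _ A (~` A).
  have [leAB leBA] := (card_eqPle A B).1 AB.
  case: (noext _ BA).
    by apply/infiniteP; rewrite -(card_le_eqr AB); exact/infiniteP.
  have UA : A `|` B #<= A by exact: card_le_setU.
  apply: card_le_trans (card_le_setX _ _ _ _ _ _ _ _ UA UA) _.
  exact: card_le_trans AA leAB.
rewrite -setXTT -(setUv A).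
have UA : A `|` ~` A #<= A by exact: card_le_setU.
apply: card_le_trans (card_le_setX _ _ _ _ _ _ _ _ UA UA) _.
apply: card_le_trans AA _.
exact: subset_card_le.
Qed.

(** A point is coded by the code of an index [i] together with its own code within [F i]; the square
    of [K] then embeds in [K]. *)
Lemma bigcup_card_le (T I K : Type) (D : set I) (F : I -> set T) :
  infinite_set [set: K] -> D #<= [set: K] ->
  (forall i, D i -> F i #<= [set: K]) -> \bigcup_(i in D) F i #<= [set: K].
Proof.
move=> Kinf /card_le_relP[R [Rtot Rinj]] FK.
have /choice[S SP] i : exists S : T -> K -> Prop, D i ->
    (forall a, F i a -> exists2 b, [set: K] b & S a b) /\
    (forall a a' b, F i a -> F i a' -> S a b -> S a' b -> a = a').
  have [/FK/card_le_relP[S ?]|nDi] := pselect (D i); first by exists S.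
  by exists (fun _ _ => False).
apply: card_le_trans (infinite_setX_card_le _ Kinf); apply/card_le_relP.
exists (fun a k => exists2 i, D i /\ F i a & R i k.1 /\ S i a k.2); split.
  move=> a [i Di Fia]; have [k _ Rik] := Rtot _ Di.
  have [k' _ Sak] := (SP _ Di).1 _ Fia.
  by exists (k, k') => //; exists i.
move=> a a' [k k'] _ _ [i [Di Fi] [/= Rik Sak]] [j [Dj Fj] [/= Rjk Sak']].
have ij := Rinj _ _ _ Di Dj Rik Rjk; rewrite -ij in Fj Sak'.
exact: (SP _ Di).2 Sak Sak'.
Qed.
(** * Meager sets *)

Lemma nowhere_dense_sub (T : topologicalType) (A B : set T) :
  A `<=` B -> nowhere_dense B -> nowhere_dense A.
Proof.
move=> AB; rewrite /nowhere_dense -!subset0 => B0.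
by apply: subset_trans B0; apply: interiorS; exact: closureS.
Qed.

Lemma nowhere_dense_closedP (T : topologicalType) (A : set T) : closed A ->
  nowhere_dense A <-> forall U, open U -> U `<=` A -> U = set0.
Proof.
rewrite /nowhere_dense closure_id => <-; split => [A0 U oU UA|h].
  by rewrite -subset0 -A0; rewrite -open_subsetE.
by apply: h; [exact: open_interior|exact: interior_subset].
Qed.

(** Since [meager] requires an exact union over [nat], each [F i] is cut down to [A] and numbers
    coding no index receive the empty set. *)
Lemma sub_bigcup_meager (I : countType) (T : topologicalType) (A : set T)
    (F : I -> set T) :
  (forall i, nowhere_dense (F i)) -> A `<=` \bigcup_i F i -> meager A.
Proof.
move=> Fnd AF.
exists (fun n => if unpickle n is Some i then A `&` F i else set0).
  move=> n; case: unpickle => [i|].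
    exact: nowhere_dense_sub (@subIsetr _ _ _) (Fnd i).
  by rewrite /nowhere_dense closure0 interior0.
apply/seteqP; split => [x Ax|x [n _]].
  have [i _ Fix] := AF _ Ax; exists (pickle i) => //.
  by rewrite pickleK.
by case: unpickle => // i [].
Qed.

Lemma meager_sub (T : topologicalType) (A B : set T) :
  A `<=` B -> meager B -> meager A.
Proof.
by move=> AB [F Fnd BF]; apply: sub_bigcup_meager Fnd _; rewrite -BF.
Qed.

(** * The Cantor space *)

Definition agree (n : nat) (x y : cantor_space) := forall i, i < n -> x i = y i.

Lemma nbhs_cantorP (x : cantor_space) (U : set cantor_space) :
  nbhs x U <-> exists n, agree n x `<=` U.
Proof.
split; last first.
  case=> n; elim: n U => [|n IH] U nU.
    by apply: filterS filterT => y _; exact: nU.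
  have : nbhs x (agree n x `&` [set y | y n = x n]).
    apply: filterI; first exact: IH.
    have /(_ x [set x n]) := @proj_continuous nat (fun=> bool) n.
    by apply; exact: discrete_set1.
  apply: filterS => y [nxy /esym xyn]; apply: nU => i.
  by rewrite ltnS leq_eqVlt => /predU1P[->//|]; exact: nxy.
(* It suffices that the filter generated by the cylinders around [x] converges to [x], which in the
   product topology is checked on each coordinate. *)
pose F := filter_from [set: nat] (fun n => agree n x).
have FF : Filter F.
  apply: filter_from_filter; first by exists 0.
  move=> i j _ _; exists (maxn i j) => // y xy; split=> k ki; apply: xy.
    by rewrite leq_max ki.
  by rewrite leq_max ki orbT.
suff : F --> x by move=> /[apply] -[n _ nU]; exists n.
apply/cvg_sup => i; apply/cvg_image.
  by apply/seteqP; split=> // b _; exists (fun=> b).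
move=> V /= /nbhs_singleton Vxi.
exists [set y : cantor_space | V (y i)].
  by exists i.+1 => // y /(_ i (ltnSn i)) /= <-.
apply/seteqP; split => [_ [y Vy <-]//|b Vb].
by exists (fun=> b).
Qed.

Lemma cantor_continuous (f : cantor_space -> cantor_space) :
  (forall n, exists m, forall x y, agree m x y -> agree n (f x) (f y)) ->
  continuous f.
Proof.
move=> fP x U /nbhs_cantorP[n nU]; have [m mf] := fP n.
by apply/nbhs_cantorP; exists m => y /mf/nU.
Qed.

(** * The Cantor space as its own square, through even and odd coordinates *)

Definition interleave (x z : cantor_space) : cantor_space :=
  fun n => if odd n then z n./2 else x n./2.
Definition evens (w : cantor_space) : cantor_space := fun n => w n.*2.
Definition odds (w : cantor_space) : cantor_space := fun n => w n.*2.+1.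

Lemma interleaveK1 x z : evens (interleave x z) = x.
Proof. by apply/funext => n; rewrite /evens /interleave odd_double doubleK. Qed.

Lemma interleaveK2 x z : odds (interleave x z) = z.
Proof.
by apply/funext => n; rewrite /odds /interleave /= odd_double /= uphalf_double.
Qed.

Lemma interleave_evens_odds w : interleave (evens w) (odds w) = w.
Proof.
apply/funext => n; rewrite /interleave /evens /odds.
by case: ifP => n2; rewrite -[in RHS](odd_double_half n) n2.
Qed.

Lemma agree_interleave n x x' z z' : agree n x x' -> agree n z z' ->
  agree n (interleave x z) (interleave x' z').
Proof.
move=> xx' zz' i i_n; have i2 : i./2 < n.
  by apply: leq_ltn_trans i_n; rewrite leq_half_double; apply: leqW; rewrite -addnn leq_addr.
by rewrite /interleave; case: ifP => _; [exact: zz'|exact: xx'].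
Qed.

Lemma interleave_continuousl z : continuous (interleave^~ z).
Proof.
by apply: cantor_continuous => n; exists n => x y xy; exact: agree_interleave.
Qed.

Lemma interleave_continuousr x : continuous (interleave x).
Proof.
by apply: cantor_continuous => n; exists n => z y zy; exact: agree_interleave.
Qed.

Lemma evens_continuous : continuous evens.
Proof.
apply: cantor_continuous => n; exists n.*2 => x y xy i i_n.
by apply: xy; rewrite ltn_double.
Qed.

Lemma odds_continuous : continuous odds.
Proof.
apply: cantor_continuous => n; exists n.*2 => x y xy i i_n.
by apply: xy; rewrite ltn_Sdouble.
Qed.

Lemma evens_open U : open U -> open (evens @` U).
Proof.
rewrite openE => oU _ [w Uw <-].
rewrite -[w]interleave_evens_odds in Uw.
have : nbhs (evens w) (interleave^~ (odds w) @^-1` U).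
  exact: (interleave_continuousl _ _ _ (oU _ Uw)).
by apply: filterS => x Ux; exists (interleave x (odds w)); rewrite ?interleaveK1.
Qed.

Lemma odds_open U : open U -> open (odds @` U).
Proof.
rewrite openE => oU _ [w Uw <-].
rewrite -[w]interleave_evens_odds in Uw.
have : nbhs (odds w) (interleave (evens w) @^-1` U).
  exact: (interleave_continuousr _ _ _ (oU _ Uw)).
by apply: filterS => z Uz; exists (interleave (evens w) z); rewrite ?interleaveK2.
Qed.

(** The fiber is closed, and a nonempty open subset of it would have the open image [[set x]],
    making [x] isolated in a perfect space. With [evens] and [odds] this gives the meagerness of
    vertical and horizontal lines. *)
Lemma meager_fiber (f : cantor_space -> cantor_space) (x : cantor_space) :
  continuous f -> (forall U, open U -> open (f @` U)) -> meager (f @^-1` [set x]).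
Proof.
move=> fc fo; apply: (@sub_bigcup_meager unit _ _ (fun=> f @^-1` [set x])).
  move=> _; apply/nowhere_dense_closedP.
    apply: preimage_closed => [w _|]; first exact: fc.
    exact/accessible_closed_set1/hausdorff_accessible/cantor_space_hausdorff.
  move=> U /fo oU Ux; rewrite -subset0 => w Uw.
  have /perfectTP/(_ x) := cantor_perfect; apply.
  have <- // : f @` U = [set x].
  by apply/seteqP; split=> [_ [u /Ux ? <-]//|_ ->]; exists w => //; exact: Ux.
by move=> w wx; exists tt.
Qed.

(* A closed nowhere dense set has, for all [z] outside a meager set, a nowhere
   dense section: otherwise the section contains a cylinder, and for each of the
   countably many cylinders the set of such [z] is closed with empty interior. *)
Lemma Kuratowski_Ulam (M : set cantor_space) : meager M ->
  meager [set z | ~ meager [set x | M (interleave x z)]].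
Proof.
move=> [F Fnd ->].
pose cyl (s : seq bool) : set cantor_space :=
  [set x | forall i, i < size s -> x i = nth false s i].
pose E (ns : nat * seq bool) :=
  [set z | cyl ns.2 `<=` [set x | closure (F ns.1) (interleave x z)]].
have Fcl n : closed (closure (F n)) by exact: closed_closure.
have Fnd' n U : open U -> U `<=` closure (F n) -> U = set0.
  move: U; apply/(nowhere_dense_closedP _ _ (Fcl n)).
  rewrite /nowhere_dense -(closure_id _).1 //; exact: Fnd.
apply: (@sub_bigcup_meager _ _ _ E).
  move=> [n s]; apply/nowhere_dense_closedP => /=.
    have -> : E (n, s) = \bigcap_(x in cyl s) interleave x @^-1` closure (F n).
      by apply/seteqP; split => z h x; exact: h.
    apply: closed_bigI => x _; apply: preimage_closed => // z _.
    exact: interleave_continuousr.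
  move=> U oU UE; rewrite -subset0 => z Uz.
  have oc : open (cyl s).
    rewrite openE => x xs; apply/nbhs_cantorP; exists (size s) => y xy i i_s.
    by rewrite -xy // xs.
  (* This open rectangle lies in the closure of [F n], hence is empty; but it contains the point
     with even part [s] padded by [false] and odd part [z]. *)
  have : (evens @^-1` cyl s) `&` (odds @^-1` U) = set0.
    apply: (Fnd' n).
      apply: openI; apply: open_comp => // w _; first exact: evens_continuous.
      exact: odds_continuous.
    by move=> w [ws /UE /(_ _ ws)] /=; rewrite interleave_evens_odds.
  move=> /seteqP[+ _] => /(_ (interleave (fun i => nth false s i) z)); apply.
  by split=> /=; rewrite ?interleaveK1 ?interleaveK2.
move=> z zM; apply: contrapT => zE; apply: zM.
apply: (@sub_bigcup_meager _ _ _
  (fun n => [set x | closure (F n) (interleave x z)])); last first.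
  by move=> x [n _ Fn]; exists n => //; exact: subset_closure.
move=> n; apply/nowhere_dense_closedP.
  by apply: (@preimage_closed _ _ (interleave^~ z)) => // x _; exact: interleave_continuousl.
move=> U; rewrite openE => oU UF; rewrite -subset0 => x /oU /nbhs_cantorP[m mU].
(* The cylinder is given by the first [m] values of [x]. *)
apply: zE; exists (n, [seq x i | i <- iota 0 m]) => // y /= ycyl; apply: UF.
apply: mU => i i_m; have := ycyl i; rewrite size_map size_iota => /(_ i_m) ->.
by rewrite (nth_map 0) ?size_iota // nth_iota.
Qed.

Theorem theorem5 (kappa lambda : Type)
    (hkappa : omega1 #<= [set: kappa])
    (hkl : [set: kappa] #<= [set: lambda])
    (hlambda : [set: lambda] #<= [set: cantor_space])
    (hM : nicely_generated kappa lambda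
            [set A : set cantor_space | meager A]) :
  [set: kappa] #= [set: lambda].
Proof.
case: hM => F [[Fcov Ftriv Fne] _ Fcup Fcof].
apply: Cantor_Bernstein => //; apply: contrapT => lk.
have kinf : infinite_set [set: kappa].
  have [R [_ ncount _]] := omega1P.
  move=> /finite_set_countable kc; apply: ncount.
  exact: sub_countable hkappa kc.
have blk w : exists a, F a w.
  have [a _ Fa] : cover setT F w by rewrite Fcov.
  by exists a.
have blk_uniq a b w : F a w -> F b w -> a = b.
  by move=> Fa Fb; apply: Ftriv => //; exists w.
(* The sets [B i] together have at most [kappa] indices, so by [lk] some index [a] is missed, and
   any point of its block avoids every [N i]. *)
have notcover (T : Type) (D : set T) (N : T -> set cantor_space) :
    D #<= [set: kappa] -> (forall i, D i -> meager (N i)) ->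
    exists x, forall i, D i -> ~ N i x.
  move=> Dk Nm; have /choice[B BP] i : exists B : set lambda, D i ->
      card_lt B [set: kappa] /\ N i `<=` \bigcup_(a in B) F a.
    have [/Nm/Fcof[B BP]|nDi] := pselect (D i); first by exists B.
    by exists set0.
  have [a aB] : exists a, ~ (\bigcup_(i in D) B i) a.
    apply/existsNP => allB; apply: lk.
    apply: (@card_le_trans _ _ _ (\bigcup_(i in D) B i)).
      by apply: subset_card_le => a _; exact: allB.
    by apply: bigcup_card_le => // i /BP[[]].
  have [x Fax] := Fne a I.
  exists x => i Di Nix; apply: aB; exists i => //.
  have [_ /(_ _ Nix)[b Bb Fbx]] := BP _ Di.
  by rewrite (blk_uniq _ _ _ Fax Fbx).
(* [col x] contains the index of every block meeting the vertical line at [x], and possibly others;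
   [row z] below does the same for the horizontal line at [z]. *)
have /choice[col colP] x : exists D : set lambda, card_lt D [set: kappa] /\
    forall z a, F a (interleave x z) -> D a.
  have [|D [Dk DF]] := Fcof (evens @^-1` [set x]).
    by apply: meager_fiber; [exact: evens_continuous|exact: evens_open].
  exists D; split=> // z a Fa; have [|b Db Fb] := DF (interleave x z).
    exact: interleaveK1.
  by rewrite (blk_uniq _ _ _ Fa Fb).
have /choice[row rowP] z : exists D : set lambda, card_lt D [set: kappa] /\
    forall x a, F a (interleave x z) -> D a.
  have [|D [Dk DF]] := Fcof (odds @^-1` [set z]).
    by apply: meager_fiber; [exact: odds_continuous|exact: odds_open].
  exists D; split=> // x a Fa; have [|b Db Fb] := DF (interleave x z).
    exact: interleaveK2.
  by rewrite (blk_uniq _ _ _ Fa Fb).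
have [pt ptP] := choice (fun a => Fne a I).
(* [L] is a copy of [kappa] among the indices, and [Z] takes one point from each of its blocks. *)
have [L _ kL] := card_le_subset _ _ _ _ hkl.
have [leKL leLK] := (card_eqPle [set: kappa] L).1 kL.
pose Z := pt @` L.
have Zk : Z #<= [set: kappa] by apply: card_le_trans (card_image_le _ _) leLK.
have Znm : ~ meager Z.
  move=> /Fcof[D [[_ nkD] ZD]]; apply: nkD.
  apply: card_le_trans leKL _; apply: subset_card_le => a La.
  have [b Db Fb] := ZD (pt a) (imageP _ La).
  by rewrite (blk_uniq _ _ _ (ptP a) Fb).
pose sec (za : cantor_space * lambda) := [set x | F za.2 (interleave x za.1)].
(* Restricting to meager sections lets [notcover] apply; there are at most [kappa] heights in [Z]
   and fewer than [kappa] indices in each row. *)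
pose J := [set za | [/\ Z za.1, row za.1 za.2 & meager (sec za)]].
have [||x xJ] := notcover _ J sec.
- apply: (@card_le_trans _ _ _ (\bigcup_(z in Z) [set (z, a) | a in row z])).
    by apply: subset_card_le => -[z a] [/= Zz ra _]; exists z => //; exists a.
  apply: bigcup_card_le => // z _; apply: card_le_trans (card_image_le _ _) _.
  by have [[]] := rowP z.
- by move=> za [].
have [colk colF] := colP x.
have Qm : meager (\bigcup_(a in col x) F a) by exact: Fcup.
have [z Zz zQ] : exists2 z, Z z &
    meager [set y | (\bigcup_(a in col x) F a) (interleave y z)].
  apply: contrapT => noz; apply: Znm.
  apply: meager_sub (Kuratowski_Ulam _ Qm) => z Zz /= zQ.
  by apply: noz; exists z.
(* The block through the point [(x, z)] has its index in both [row z] and [col x]. The latter makes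
   its section at [z] meager, so [(z, a)] is in [J], although [x] was chosen outside all such
   sections. *)
have [a Fa] := blk (interleave x z).
apply: (xJ (z, a)) => //; split => //=; first exact: (rowP z).2 Fa.
by apply: meager_sub zQ => y Fy; exists a => //; exact: colF Fa.
Qed.
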